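(* Let $F$ be a field of characteristic different from $2$. In the class of Lie-solvable Novikov algebras over $F$, the following classes coincide: (1) the class of Baer-radical algebras; (2) the class of r-nil algebras; (3) the class of locally solvable algebras. That is, for every Lie-solvable Novikov algebra $A$ over $F$ the following conditions are equivalent: (1) $A=\mathcal{B}(A)$; (2) $A$ is r-nil; (3) $A$ is locally solvable.
   Context: A Novikov algebra over a field $F$ is a (not necessarily associative or unital) $F$-algebra satisfying the identities $(x,y,z)=(y,x,z)$ and $(xy)z=(xz)y$, where $(x,y,z)=(xy)z-x(yz)$. Left-normed powers of an element: $x^1=x$, $x^n=x^{n-1}x$ for $n>1$. An element $x$ is r-nilpotent if $x^n=0$ for some $n>0$; an algebra is r-nil if all its elements are r-nilpotent. Ideals are two-sided. For an ideal $I$ of a Novikov algebra, $[I,I]$ denotes the linear span of all commutators $[a,b]=ab-ba$, $a,b\in I$; it is again an ideal of the algebra. Put $A^{(0)_L}=A$, $A^{(n+1)_L}=[A^{(n)_L},A^{(n)_L}]$. $A$ is Lie-solvable if $A^{(n)_L}=0$ for some $n\ge 0$. An algebra $B$ is solvable if $B^{(m)}=0$ for some $m$, where $B^{(0)}=B$ and $B^{(m+1)}=B^{(m)}B^{(m)}$ (span of products). An algebra is locally solvable if each of its finitely generated subalgebras is solvable. Baer radical: an ideal $I$ is trivial if $I^2=0$. Set $\mathcal{B}_0(A)=0$ and let $\mathcal{B}_1(A)$ be the sum of all trivial ideals of $A$. For a limit ordinal $\alpha$, $\mathcal{B}_\alpha(A)=\bigcup_{\beta<\alpha}\mathcal{B}_\beta(A)$;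 for a successor ordinal $\alpha$, $\mathcal{B}_\alpha(A)$ is the full preimage in $A$ of $\mathcal{B}_1(A/\mathcal{B}_{\alpha-1}(A))$ under the quotient map. The Baer radical is $\mathcal{B}(A)=\mathcal{B}_\delta(A)$ for an ordinal $\delta$ with $\delta>|A|$ (the chain has stabilized by then). $A$ is Baer-radical if $A=\mathcal{B}(A)$. *)

(* Defs.v *)
From HB Require Import structures.
From mathcomp Require Import all_boot all_order all_algebra.
From mathcomp Require Import boolp classical_sets functions cardinality wochoice.

Set Implicit Arguments.
Unset Strict Implicit.
Unset Printing Implicit Defensive.

Import GRing.Theory.
Local Open Scope ring_scope.
Local Open Scope quotient_scope.
Local Open Scope classical_set_scope.
Local Open Scope card_scope.

HB.mixin Record Lmodule_isNonAssocAlgebra (F : fieldType) A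
    of GRing.Lmodule F A := {
  amul : A -> A -> A;
  amul_linearl : forall y : A, linear (amul ^~ y);
  amul_linearr : forall x : A, linear (amul x)
}.

#[short(type="nonAssocAlgType")]
HB.structure Definition NonAssocAlgebra (F : fieldType) :=
  {A of Lmodule_isNonAssocAlgebra F A & GRing.Lmodule F A}.

Declare Scope na_scope.
Delimit Scope na_scope with na.
Notation "x ∘ y" := (amul x y) (at level 40, left associativity) : na_scope.
Local Open Scope na_scope.

Section NonAssocAlgebra.
Variables (F : fieldType) (A : nonAssocAlgType F).
Implicit Types (x y z : A) (S T : set A).

Definition associator x y z := (x ∘ y) ∘ z - x ∘ (y ∘ z).

Definition commutator x y := x ∘ y - y ∘ x.

Definition novikov : Prop :=
  (forall x y z, associator x y z = associator y x z) /\
  (forall x y z, (x ∘ y) ∘ z = (x ∘ z) ∘ y).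

(** [rpow x n] is the left-normed power x^n for [0 < n]; [rpow x 0] is junk. *)
Definition rpow x n : A := iter n.-1 (fun y => y ∘ x) x.

Definition r_nilpotent x : Prop := exists2 n, (0 < n)%N & rpow x n = 0.

Definition r_nil : Prop := forall x, r_nilpotent x.

Definition lin_span S : set A :=
  [set x | exists2 s : seq (F * A),
     (forall p, p \in s -> S p.2) & x = \sum_(p <- s) p.1 *: p.2].

Definition is_subspace S : Prop :=
  S 0 /\ forall (c : F) x y, S x -> S y -> S (c *: x + y).

Definition is_subalgebra S : Prop :=
  is_subspace S /\ forall x y, S x -> S y -> S (x ∘ y).

Definition is_ideal S : Prop :=
  is_subspace S /\ forall a x, S x -> S (a ∘ x) /\ S (x ∘ a).

Definition lie_square S : set A :=
  lin_span [set commutator a b | a in S & b in S].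

Definition lie_derived n : set A := iter n lie_square [set: A].

Definition lie_solvable : Prop := exists n, lie_derived n = [set 0].

Definition alg_square S : set A := lin_span [set a ∘ b | a in S & b in S].

Definition alg_derived S n : set A := iter n alg_square S.

Definition solvable_subalgebra S : Prop := exists n, alg_derived S n = [set 0].

Definition generated_subalgebra (s : seq A) : set A :=
  smallest is_subalgebra [set x | x \in s].

Definition locally_solvable : Prop :=
  forall s : seq A, solvable_subalgebra (generated_subalgebra s).

Definition trivial_ideal S : Prop :=
  is_ideal S /\ alg_square S = [set 0].

Definition baer1 : set A :=
  [set x | exists2 s : seq A,
     (forall y, y \in s -> exists2 I, trivial_ideal I & I y) &
     x = \sum_(y <- s) y].

Record ideal := Ideal { ideal_set :> set A; idealP : is_ideal ideal_set }.

End NonAssocAlgebra.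

Arguments novikov {F} A.
Arguments r_nil {F} A.
Arguments lie_derived {F} A n.
Arguments lie_solvable {F} A.
Arguments locally_solvable {F} A.
Arguments baer1 {F} A.
Arguments ideal {F} A.

Section QuotientAlgebra.
Variables (F : fieldType) (A : nonAssocAlgType F) (I : ideal A).

Definition ideal_pred : {pred A} := fun x => `[< ideal_set I x >].

Fact ideal_pred_zmod_closed : zmod_closed ideal_pred.
Proof.
have [[I0 IZD] _] := idealP I.
split=> [|x y /asboolP Ix /asboolP Iy]; apply/asboolP => //.
by rewrite addrC -scaleN1r; apply: IZD.
Qed.

HB.instance Definition _ :=
  GRing.isZmodClosed.Build A ideal_pred ideal_pred_zmod_closed.

Definition quot_alg : Type := Quotient.quot ideal_pred.

HB.instance Definition _ := GRing.Zmodule.on quot_alg.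

Definition quot_proj : A -> quot_alg := \pi_quot_alg.

Lemma quot_projP (x y : A) : quot_proj x = quot_proj y <-> ideal_set I (x - y).
Proof.
have E : (`[< ideal_set I (x - y) >] : bool) = (quot_proj x == quot_proj y).
  exact: (@Quotient.idealrBE A ideal_pred x y).
split=> [/eqP|Ixy]; first by rewrite -E => /asboolP.
by apply/eqP; rewrite -E; apply/asboolP.
Qed.

Lemma quot_projD : {morph quot_proj : x y / x + y}.
Proof. by move=> x y; exact: (@Quotient.pi_add A ideal_pred x y). Qed.

Lemma quot_projK : cancel (repr : quot_alg -> A) quot_proj.
Proof. exact: reprK. Qed.

Definition quot_scale (c : F) (u : quot_alg) : quot_alg :=
  quot_proj (c *: repr u).

Definition quot_mul (u v : quot_alg) : quot_alg := quot_proj (repr u ∘ repr v).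

Let repr_projI x : ideal_set I (repr (quot_proj x) - x).
Proof. by apply/quot_projP; rewrite quot_projK. Qed.

Lemma quot_projZ c x : quot_proj (c *: x) = quot_scale c (quot_proj x).
Proof.
have [[I0 IZD] _] := idealP I.
symmetry; apply/quot_projP; rewrite -scalerBr -[_ *: _]addr0.
exact: IZD.
Qed.

Lemma quot_projM : {morph quot_proj : x y / x ∘ y >-> quot_mul x y}.
Proof.
move=> x y; have [[I0 IZD] IM] := idealP I.
have mulBl a b c : (a - b) ∘ c = a ∘ c - b ∘ c.
  rewrite addrC -scaleN1r; have /= -> := amul_linearl c (-1) b a.
  by rewrite scaleN1r addrC.
have mulBr a b c : c ∘ (a - b) = c ∘ a - c ∘ b.
  rewrite addrC -scaleN1r; have /= -> := amul_linearr c (-1) b a.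
  by rewrite scaleN1r addrC.
symmetry; apply/quot_projP.
set x' := repr _; set y' := repr _.
rewrite (_ : _ - _ = 1 *: ((x' - x) ∘ y') + x ∘ (y' - y)); last first.
  by rewrite mulBl mulBr scale1r addrA subrK.
have [_ Ixy'] := IM y' _ (repr_projI x).
have [Ixy _] := IM x _ (repr_projI y).
exact: IZD.
Qed.

Fact quot_scaleA c d u : quot_scale c (quot_scale d u) = quot_scale (c * d) u.
Proof. by rewrite -(quot_projK u) -!quot_projZ scalerA. Qed.

Fact quot_scale1 : left_id 1 quot_scale.
Proof. by move=> u; rewrite -(quot_projK u) -quot_projZ scale1r. Qed.

Fact quot_scaleDr : right_distributive quot_scale +%R.
Proof.
move=> c u v; rewrite -(quot_projK u) -(quot_projK v).
by rewrite -quot_projD -!quot_projZ -quot_projD scalerDr.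
Qed.

Fact quot_scaleDl u : {morph quot_scale^~ u : c d / c + d}.
Proof.
move=> c d; rewrite -(quot_projK u).
by rewrite -!quot_projZ -quot_projD scalerDl.
Qed.

HB.instance Definition _ := GRing.Zmodule_isLmodule.Build F quot_alg
  quot_scaleA quot_scale1 quot_scaleDr quot_scaleDl.

Fact quot_mul_linearl (v : quot_alg) : linear (quot_mul ^~ v).
Proof.
move=> c u w; rewrite -[LHS]/(quot_mul (quot_scale c u + w) v).
rewrite -[RHS]/(quot_scale c (quot_mul u v) + quot_mul w v).
rewrite -(quot_projK u) -(quot_projK v) -(quot_projK w).
rewrite -quot_projZ -quot_projD -!quot_projM -quot_projZ -quot_projD.
by congr quot_proj; apply: amul_linearl.
Qed.

Fact quot_mul_linearr (v : quot_alg) : linear (quot_mul v).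
Proof.
move=> c u w; rewrite -[LHS]/(quot_mul v (quot_scale c u + w)).
rewrite -[RHS]/(quot_scale c (quot_mul v u) + quot_mul v w).
rewrite -(quot_projK u) -(quot_projK v) -(quot_projK w).
rewrite -quot_projZ -quot_projD -!quot_projM -quot_projZ -quot_projD.
by congr quot_proj; apply: amul_linearr.
Qed.

HB.instance Definition _ := Lmodule_isNonAssocAlgebra.Build F quot_alg
  quot_mul_linearl quot_mul_linearr.

End QuotientAlgebra.

Arguments quot_proj {F A} I x.

(** Ordinals are represented by the elements of a well-ordered type: an
  element stands for the order type of the initial segment below it. *)

Section WellOrderedTypes.
Variables (W : Type) (le : rel W).

Definition wlt (v w : W) : Prop := le v w /\ v <> w.

Definition is_least (w : W) : Prop := forall v, ~ wlt v w.

Definition is_succ (v w : W) : Prop :=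
  wlt v w /\ forall u, wlt u w -> le u v.

Definition is_limit (w : W) : Prop :=
  ~ is_least w /\ forall v, ~ is_succ v w.

(** [delta > |T|]: some [kappa] strictly below [delta] has at least [|T|]
  elements below it, i.e. dominates the initial ordinal of [|T|]. *)
Definition exceeds_card (T : Type) (delta : W) : Prop :=
  exists2 kappa, wlt kappa delta & [set: T] #<= [set v | wlt v kappa].

End WellOrderedTypes.

Section BaerRadical.
Variables (F : fieldType) (A : nonAssocAlgType F).

Record baer_chain (W : Type) (le : rel W) (B : W -> ideal A) : Prop := {
  baer_chain0 : forall w, is_least le w -> ideal_set (B w) = [set 0];
  baer_chainS : forall v w, is_succ le v w ->
    ideal_set (B w) = quot_proj (B v) @^-1` baer1 (quot_alg (B v));
  baer_chainL : forall w, is_limit le w ->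
    ideal_set (B w) = \bigcup_(v in [set v | wlt le v w]) ideal_set (B v)
}.

(** By well-founded recursion the chain is determined by the well-order, and it
  is stationary beyond [|A|], so the ordinal [delta > |A|] is immaterial. *)
Definition baer_radical : set A :=
  [set x | exists (W : Type) (le : rel W) (B : W -> ideal A) (delta : W),
    [/\ well_order le, baer_chain le B, exceeds_card le A delta &
        ideal_set (B delta) x]].

Definition baer_radical_algebra : Prop := [set: A] = baer_radical.

End BaerRadical.

Arguments baer_radical {F} A.
Arguments baer_radical_algebra {F} A.

(* Main.v *)
Require Import Defs.
From mathcomp Require Import all_boot all_order all_algebra.
From mathcomp Require Import boolp classical_sets functions cardinality wochoice.
From mathcomp Require Import zify.

(** In the model [x ∘ y = x y'] of a Novikov algebra, the product [x^k x^l] is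
  [x^(k+l) + (l-1) w], where [w] depends only on [k + l]. So if a subspace [S]
  contains all large powers of [x], then so does [S S]: powers of [x] that
  enter a solvable ideal modulo an ideal [I] end up in [I]. This gives
  r-nilpotency from local solvability, and also from Baer-radicality by
  transfinite induction along the Baer chain, since a finite sum of trivial
  ideals is solvable.

  In characteristic not 2, [[J, J]] is an ideal for every ideal [J], and with
  [I = [J, J]] one has [(I I) I <= [I, I]]; hence [D = [A, A]] is solvable when
  [A] is Lie-solvable. As [A / D] is commutative and associative, each
  r-nilpotent element of [A] lies in a solvable ideal. Finite sums of such ideals
  give local solvability; and if the stage [I] of the Baer chain misses [x], the
  last term not below [I] of the derived series of a solvable ideal containing
  [x] is a trivial ideal modulo [I], so the chain grows until it reaches [A]. *)

Set Implicit Arguments.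
Unset Strict Implicit.
Unset Printing Implicit Defensive.

Import GRing.Theory.
Local Open Scope ring_scope.
Local Open Scope classical_set_scope.
Local Open Scope card_scope.
Local Open Scope na_scope.

(** * Bilinearity of the product *)

Section Bilinearity.
Variables (F : fieldType) (A : nonAssocAlgType F).
Implicit Types (c : F) (x y z : A).

Lemma amulDl x y z : (x + y) ∘ z = x ∘ z + y ∘ z.
Proof. by have := amul_linearl z 1 x y; rewrite /= !scale1r. Qed.

Lemma amulDr x y z : x ∘ (y + z) = x ∘ y + x ∘ z.
Proof. by have := amul_linearr x 1 y z; rewrite /= !scale1r. Qed.

Lemma amul0l x : 0 ∘ x = 0 :> A.
Proof. by apply: (addIr (0 ∘ x)); rewrite -amulDl !add0r. Qed.

Lemma amul0r x : x ∘ 0 = 0 :> A.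
Proof. by apply: (addIr (x ∘ 0)); rewrite -amulDr !add0r. Qed.

Lemma amulZl c x y : (c *: x) ∘ y = c *: (x ∘ y).
Proof. by have := amul_linearl y c x 0; rewrite /= !addr0 amul0l addr0. Qed.

Lemma amulZr c x y : x ∘ (c *: y) = c *: (x ∘ y).
Proof. by have := amul_linearr x c y 0; rewrite /= !addr0 amul0r addr0. Qed.

Lemma amulNl x y : (- x) ∘ y = - (x ∘ y).
Proof. by rewrite -scaleN1r amulZl scaleN1r. Qed.

Lemma amulNr x y : x ∘ (- y) = - (x ∘ y).
Proof. by rewrite -scaleN1r amulZr scaleN1r. Qed.

Lemma amulBl x y z : (x - y) ∘ z = x ∘ z - y ∘ z.
Proof. by rewrite amulDl amulNl. Qed.

Lemma amulBr x y z : x ∘ (y - z) = x ∘ y - x ∘ z.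
Proof. by rewrite amulDr amulNr. Qed.

Lemma rpowS x n : (0 < n)%N -> rpow x n.+1 = rpow x n ∘ x.
Proof. by case: n. Qed.

End Bilinearity.

(** * Subspaces, ideals, spans, and solvability modulo an ideal *)

Section Subspaces.
Variables (F : fieldType) (A : nonAssocAlgType F).
Implicit Types (I J K S T : set A) (c : F) (x y z : A).

Lemma subspaceD S x y : is_subspace S -> S x -> S y -> S (x + y).
Proof. by move=> [_ SZD] Sx Sy; rewrite -[x]scale1r; apply: SZD. Qed.

Lemma subspaceZ S c x : is_subspace S -> S x -> S (c *: x).
Proof. by move=> [S0 SZD] Sx; rewrite -[_ *: _]addr0; apply: SZD. Qed.

Lemma subspaceN S x : is_subspace S -> S x -> S (- x).
Proof. by move=> sS Sx; rewrite -scaleN1r; apply: subspaceZ. Qed.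

Lemma subspaceB S x y : is_subspace S -> S x -> S y -> S (x - y).
Proof. by move=> sS Sx Sy; apply: subspaceD => //; apply: subspaceN. Qed.

Lemma subspace_sum S (T : eqType) (s : seq T) (f : T -> A) :
  is_subspace S -> (forall p, p \in s -> S (f p)) -> S (\sum_(p <- s) f p).
Proof.
move=> sS Sf; rewrite big_seq; elim/big_ind: _ => // [|x y].
  by have [] := sS.
exact: subspaceD.
Qed.

Lemma subspace0 : is_subspace ([set 0] : set A).
Proof. by split=> // c x y /= -> ->; rewrite scaler0 addr0. Qed.

Lemma ideal0 : is_ideal ([set 0] : set A).
Proof.
by split; [exact: subspace0|move=> a x /= ->; rewrite amul0l amul0r].
Qed.

Lemma ideal_subspace I : is_ideal I -> is_subspace I.
Proof. by case. Qed.

Lemma idealMl I a x : is_ideal I -> I x -> I (a ∘ x).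
Proof. by move=> [_ iI] /(iI a) []. Qed.

Lemma idealMr I a x : is_ideal I -> I x -> I (x ∘ a).
Proof. by move=> [_ iI] /(iI a) []. Qed.

Lemma ideal_subalgebra I : is_ideal I -> is_subalgebra I.
Proof. by move=> iI; split=> [|x y Ix _]; [case: iI|exact: idealMr]. Qed.

Lemma sub_lin_span S : S `<=` lin_span S.
Proof.
move=> x Sx; exists [:: (1, x)]; last by rewrite big_seq1 scale1r.
by move=> p; rewrite inE => /eqP ->.
Qed.

Lemma lin_span_sub S T : is_subspace T -> S `<=` T -> lin_span S `<=` T.
Proof.
move=> sT ST x [s sS ->]; apply: subspace_sum => // p /sS/ST.
exact: subspaceZ.
Qed.

Lemma lin_span_subspace S : is_subspace (lin_span S).
Proof.
split=> [|c x y [s sS ->] [t tS ->]].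
  by exists [::] => //; rewrite big_nil.
exists ([seq (c * p.1, p.2) | p <- s] ++ t).
  by move=> p; rewrite mem_cat => /orP [/mapP [q /sS Sq ->]|/tS].
rewrite big_cat big_map scaler_sumr; congr (_ + _).
by apply: eq_bigr => p _; rewrite scalerA.
Qed.

(** For a fixed [a], the elements whose products with [a] on both sides lie in the span form a
    subspace, so it suffices to test generators. *)
Lemma lin_span_ideal S :
  (forall a x, S x -> lin_span S (a ∘ x) /\ lin_span S (x ∘ a)) ->
  is_ideal (lin_span S).
Proof.
move=> SM; have sS := lin_span_subspace S; split=> // a x Sx.
pose T := [set y | lin_span S (a ∘ y) /\ lin_span S (y ∘ a)].
suff : lin_span S `<=` T by apply.
apply: lin_span_sub => [|y Sy]; last exact: SM.
split=> [|c y z [Sy1 Sy2] [Sz1 Sz2]]; first by rewrite /T /= amul0l amul0r; case: sS.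
by case: sS => S0 SZD; split; rewrite ?amulDl ?amulDr ?amulZl ?amulZr; apply: SZD.
Qed.

Lemma alg_square_sub S T :
  is_subspace T -> (forall x y, S x -> S y -> T (x ∘ y)) -> alg_square S `<=` T.
Proof.
by move=> sT ST; apply: lin_span_sub => // _ [x Sx [y Sy <-]]; apply: ST.
Qed.

Lemma alg_square_subspace S : is_subspace (alg_square S).
Proof. exact: lin_span_subspace. Qed.

Lemma mem_alg_square S x y : S x -> S y -> alg_square S (x ∘ y).
Proof. by move=> Sx Sy; apply: sub_lin_span; exists x => //; exists y. Qed.

Lemma alg_square_mono S T : S `<=` T -> alg_square S `<=` alg_square T.
Proof.
move=> ST; apply: alg_square_sub => [|x y /ST Tx /ST Ty].
  exact: lin_span_subspace.
exact: mem_alg_square.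
Qed.

Lemma alg_derived_mono S T n : S `<=` T -> alg_derived S n `<=` alg_derived T n.
Proof.
by move=> ST; elim: n => //= n; rewrite /alg_derived /=; apply: alg_square_mono.
Qed.

Lemma alg_derivedD S m n :
  alg_derived S (m + n) = alg_derived (alg_derived S n) m.
Proof. exact: iterD. Qed.

Lemma alg_derived_subspace S n : is_subspace S -> is_subspace (alg_derived S n).
Proof. by move=> sS; case: n => //= n; apply: lin_span_subspace. Qed.

Lemma solvable_subalgebraP S :
  is_subspace S ->
  solvable_subalgebra S <-> exists n, alg_derived S n `<=` [set 0].
Proof.
move=> sS; split=> - [n Sn0]; exists n; rewrite ?Sn0 //.
apply/seteqP; split=> // x ->.
by case: (alg_derived_subspace n sS).
Qed.

Lemma lie_square_subspace S : is_subspace (lie_square S).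
Proof. exact: lin_span_subspace. Qed.

Lemma mem_lie_square S x y : S x -> S y -> lie_square S (commutator x y).
Proof. by move=> Sx Sy; apply: sub_lin_span; exists x => //; exists y. Qed.

Lemma lie_square_sub S T : is_subspace T ->
  (forall x y, S x -> S y -> T (commutator x y)) -> lie_square S `<=` T.
Proof.
by move=> sT ST; apply: lin_span_sub => // _ [x Sx [y Sy <-]]; apply: ST.
Qed.

Definition sum_set S T : set A := [set x + y | x in S & y in T].

Lemma sum_set_subspace S T :
  is_subspace S -> is_subspace T -> is_subspace (sum_set S T).
Proof.
move=> [S0 SZD] [T0 TZD]; split.
  by exists 0 => //; exists 0 => //; rewrite addr0.
move=> c _ _ [x Ix [y Jy <-]] [x' Ix' [y' Jy' <-]].
exists (c *: x + x'); first exact: SZD.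
exists (c *: y + y'); first exact: TZD.
by rewrite scalerDr addrACA.
Qed.

Lemma sum_set_ideal I J : is_ideal I -> is_ideal J -> is_ideal (sum_set I J).
Proof.
move=> iI iJ; split=> [|a _ [x Ix [y Jy <-]]].
  by apply: sum_set_subspace; exact: ideal_subspace.
split; [exists (a ∘ x); first exact: idealMl|exists (x ∘ a); first exact: idealMr].
  by exists (a ∘ y); [exact: idealMl|rewrite amulDr].
by exists (y ∘ a); [exact: idealMr|rewrite amulDl].
Qed.

Lemma sum_set_subl S T : T 0 -> S `<=` sum_set S T.
Proof. by move=> T0 x Sx; exists x => //; exists 0 => //; rewrite addr0. Qed.

Lemma sum_set_subr S T : S 0 -> T `<=` sum_set S T.
Proof. by move=> S0 x Tx; exists 0 => //; exists x => //; rewrite add0r. Qed.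

Lemma alg_derived_sum S J n : is_subspace S -> is_ideal J ->
  alg_derived (sum_set S J) n `<=` sum_set (alg_derived S n) J.
Proof.
move=> sS iJ; elim: n => //= n IHn; apply: alg_square_sub.
  by apply: sum_set_subspace; [exact: lin_span_subspace|case: iJ].
have sJ := ideal_subspace iJ.
move=> _ _ /IHn [a Sa [b Jb <-]] /IHn [a' Sa' [b' Jb' <-]].
exists (a ∘ a'); first exact: mem_alg_square.
exists (a ∘ b' + b ∘ (a' + b')).
  by apply: subspaceD => //; [apply: idealMl|apply: idealMr].
by rewrite addrA -amulDr amulDl.
Qed.

(** For an ideal [I] this is solvability of the image of [J] in [A / I], phrased inside [A] so that
    no quotient has to be formed. *)
Definition solvable_mod I J : Prop := exists n, alg_derived J n `<=` I.

(** An extension argument: [m] steps bring [J + K] into [K + I], and [n] more bring that into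
    [I]. *)
Lemma solvable_mod_sum I J K : is_ideal I -> is_ideal J -> is_ideal K ->
  solvable_mod I J -> solvable_mod I K -> solvable_mod I (sum_set J K).
Proof.
move=> iI iJ iK [m JI] [n KI]; exists (n + m)%N; rewrite alg_derivedD.
have JKI : alg_derived (sum_set J K) m `<=` sum_set K I.
  move=> x /(alg_derived_sum (ideal_subspace iJ) iK) [y /JI Iy [z Kz <-]].
  by exists z => //; exists y => //; rewrite addrC.
move=> x /(alg_derived_mono JKI) /(alg_derived_sum (ideal_subspace iK) iI).
move=> [y /KI Iy [z Iz <-]].
by apply: subspaceD => //; case: iI.
Qed.

Lemma solvable_mod_seq I (T : eqType) (s : seq T) (f : T -> A) : is_ideal I ->
  (forall p, p \in s -> exists J, [/\ is_ideal J, solvable_mod I J & J (f p)]) ->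
  exists J, [/\ is_ideal J, solvable_mod I J, I `<=` J &
    forall p, p \in s -> J (f p)].
Proof.
move=> iI; elim: s => [|p s IHs] sJ.
  by exists I; split=> //; exists 0%N.
have [|J [iJ sIJ IJ Js]] := IHs; first by move=> q qs; apply: sJ; rewrite inE qs orbT.
have [K [iK sIK Kp]] := sJ p (mem_head _ _).
have K0 : K 0 by case: iK => [] [].
have J0 : J 0 by case: iJ => [] [].
exists (sum_set J K); split.
- exact: sum_set_ideal.
- exact: solvable_mod_sum.
- by move=> x /IJ; exact: sum_set_subl.
move=> q; rewrite inE => /orP [/eqP ->|/Js Jq]; first exact: sum_set_subr.
exact: sum_set_subl.
Qed.

End Subspaces.

(** * Images and preimages under the projection to a quotient *)

Section Quotient.
Variables (F : fieldType) (A : nonAssocAlgType F) (I : ideal A).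
Local Notation pi := (quot_proj I).

Lemma quot_proj00 : pi 0 = 0.
Proof. by apply: (addIr (pi 0)); rewrite -quot_projD !add0r. Qed.

Lemma quot_proj0 x : pi x = 0 <-> ideal_set I x.
Proof. by rewrite -quot_proj00 quot_projP subr0. Qed.

Lemma quot_projMM x y : pi (x ∘ y) = pi x ∘ pi y.
Proof. exact: quot_projM. Qed.

Lemma quot_projZZ c x : pi (c *: x) = c *: pi x.
Proof. exact: quot_projZ. Qed.

Lemma quot_projB x y : pi (x - y) = pi x - pi y.
Proof. by rewrite quot_projD -scaleN1r quot_projZZ scaleN1r. Qed.

Lemma quot_proj_surj u : exists x, pi x = u.
Proof. by exists (repr u); apply: quot_projK. Qed.

Lemma quot_proj_sum (T : Type) (s : seq T) (f : T -> A) :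
  pi (\sum_(i <- s) f i) = \sum_(i <- s) pi (f i).
Proof. by apply: big_morph; [exact: quot_projD|exact: quot_proj00]. Qed.

Lemma quot_proj_rpow x n : pi (rpow x n) = rpow (pi x) n.
Proof.
by rewrite /rpow; elim: n.-1 => //= m IHm; rewrite quot_projMM IHm.
Qed.

Lemma novikov_quot : novikov A -> novikov (quot_alg I).
Proof.
move=> [ls rc]; split=> u v w; have [x <-] := quot_proj_surj u;
  have [y <-] := quot_proj_surj v; have [z <-] := quot_proj_surj w.
  by have := congr1 pi (ls x y z); rewrite /associator !quot_projB !quot_projMM.
by have := congr1 pi (rc x y z); rewrite !quot_projMM.
Qed.

Lemma image_subspace S : is_subspace S -> is_subspace (pi @` S).
Proof.
move=> [S0 SZD]; split; first by exists 0 => //; rewrite quot_proj00.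
move=> c _ _ [x Sx <-] [y Sy <-]; exists (c *: x + y); first exact: SZD.
by rewrite quot_projD quot_projZZ.
Qed.

Lemma image_ideal J : is_ideal J -> is_ideal (pi @` J).
Proof.
move=> iJ; split=> [|u _ [x Jx <-]]; first by apply: image_subspace; case: iJ.
have [a <-] := quot_proj_surj u; rewrite -!quot_projMM.
by split; [exists (a ∘ x) => //; apply: idealMl|exists (x ∘ a) => //; apply: idealMr].
Qed.

Lemma preimage_subspace (S : set (quot_alg I)) :
  is_subspace S -> is_subspace (pi @^-1` S).
Proof.
move=> [S0 SZD]; split=> [|c x y Sx Sy]; rewrite /preimage /=.
  by rewrite quot_proj00.
by rewrite quot_projD quot_projZZ; apply: SZD.
Qed.

Lemma preimage_ideal (J : set (quot_alg I)) :
  is_ideal J -> is_ideal (pi @^-1` J).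
Proof.
move=> iJ; split=> [|a x Jx]; first exact: preimage_subspace (ideal_subspace iJ).
by case: iJ => _ JM; rewrite /preimage /= !quot_projMM; apply: JM.
Qed.

Lemma ideal_sub_preimage (J : set (quot_alg I)) :
  is_ideal J -> ideal_set I `<=` pi @^-1` J.
Proof.
by move=> [[J0 _] _] x /quot_proj0; rewrite /preimage /= => ->.
Qed.

Lemma alg_derived_preimage (S : set (quot_alg I)) n :
  alg_derived (pi @^-1` S) n `<=` pi @^-1` alg_derived S n.
Proof.
elim: n => //= n IHn; apply: alg_square_sub => [|x y /IHn Sx /IHn Sy].
  exact: preimage_subspace (alg_square_subspace _).
by rewrite /preimage /= quot_projMM; apply: mem_alg_square.
Qed.

End Quotient.

(** * Novikov identities: squares of ideals, powers, commutator ideals *)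

Section Novikov.
Variables (F : fieldType) (A : nonAssocAlgType F).
Hypothesis novA : novikov A.
Implicit Types (I J K : set A) (a b c d u v w x y z : A).

Let ls x y z : associator x y z = associator y x z.
Proof. by case: novA. Qed.

Let rc x y z : x ∘ y ∘ z = x ∘ z ∘ y.
Proof. by case: novA. Qed.

Lemma amul_amulr x y z : x ∘ (y ∘ z) = x ∘ y ∘ z - associator x y z.
Proof. by rewrite subKr. Qed.

(** Right multiplications commute, so [w] moves to the far right in both terms of the associator. *)
Lemma associator_amul x y z w :
  associator (x ∘ w) y z = associator x y z ∘ w.
Proof. by rewrite /associator amulBl ![_ ∘ w ∘ _]rc (rc _ z w) (rc _ (y ∘ z)). Qed.

(** Left symmetry (for multiplication from the left) and right commutativity (from the right) move
    the outer factor onto a factor in [I]. *)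
Lemma alg_square_ideal I : is_ideal I -> is_ideal (alg_square I).
Proof.
move=> iI; apply: lin_span_ideal => c _ [a Ia [b Ib <-]]; split.
  have -> : c ∘ (a ∘ b) = c ∘ a ∘ b - a ∘ c ∘ b + a ∘ (c ∘ b).
    by rewrite !amul_amulr ls addrA subrK.
  have sI := alg_square_subspace I.
  apply: subspaceD => //; first apply: subspaceB => //.
  - by apply: mem_alg_square => //; apply: idealMl.
  - by apply: mem_alg_square => //; apply: idealMr.
  - by apply: mem_alg_square => //; apply: idealMl.
by rewrite rc; apply: mem_alg_square => //; apply: idealMr.
Qed.

Lemma alg_derived_ideal I n : is_ideal I -> is_ideal (alg_derived I n).
Proof. by move=> iI; elim: n => //= n; apply: alg_square_ideal. Qed.

(** The associators [(x^k, x^l, x)] depend only on [k + l]. *)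
Lemma associator_rpow x k l : (0 < k)%N -> (0 < l)%N ->
  associator (rpow x k.+1) (rpow x l) x = associator (rpow x k) (rpow x l.+1) x.
Proof.
by move=> k0 l0; rewrite !rpowS // associator_amul [RHS]ls associator_amul ls.
Qed.

Lemma amul_rpowS x k l : (0 < k)%N -> (0 < l)%N ->
  rpow x k.+1 ∘ rpow x l =
  rpow x k ∘ rpow x l.+1 + associator (rpow x k) (rpow x l) x.
Proof. by move=> k0 l0; rewrite !rpowS // amul_amulr subrK rc. Qed.

(** Products of two large powers lie in [J]. Comparing two neighbouring products of equal degree
    puts their associator in [J]; as it depends only on the degree, it is also the cost of every
    further shift of a factor [x], until the right factor is [x] itself. *)
Lemma rpow_alg_square S J x n : (0 < n)%N -> is_subspace J ->
  (forall k, (n <= k)%N -> S (rpow x k)) -> alg_square S `<=` J ->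
  forall k, (n.*2 < k)%N -> J (rpow x k).
Proof.
move=> n0 sJ Sx SJ.
have Jmul k l : (n <= k)%N -> (n <= l)%N -> J (rpow x k ∘ rpow x l).
  by move=> /Sx Sk /Sx Sl; apply/SJ/mem_alg_square.
(* Normal form: the second exponent is moved to the first argument until only 1 is left. *)
have assE k l : (0 < k)%N -> (0 < l)%N ->
    associator (rpow x k) (rpow x l) x = associator (rpow x (k + l).-1) (rpow x 1) x.
  move=> k0; elim: l k k0 => // -[|l] IHl k k0 _; first by rewrite addn1.
  by rewrite -associator_rpow // IHl // addSnnS.
(* The associator is the difference of [x^(N-n+1) x^n] and [x^(N-n) x^(n+1)]; [2n <= N] keeps all
   four exponents at least [n]. *)
have Jass N : (n.*2 <= N)%N -> J (associator (rpow x N.-1) (rpow x 1) x).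
  move=> nN; have nNn : (n <= N - n)%N by rewrite leq_subRL -?addnn; lia.
  have := amul_rpowS x (leq_trans n0 nNn) n0.
  rewrite (assE (N - n)%N) // ?subnK; [|lia|lia].
  move/eqP; rewrite addrC -subr_eq => /eqP <-.
  by apply: subspaceB => //; apply: Jmul; lia.
case=> // M nM.
(* Start from [x^(M+1-n) x^n] and shift [j] factors to the left power; [j = n - 1] leaves
   [x^M x]. *)
have Jprod j : (j < n)%N -> J (rpow x (M.+1 - (n - j)) ∘ rpow x (n - j)).
  elim: j => [|j IHj] jn; first by apply: Jmul; lia.
  have -> : (M.+1 - (n - j.+1) = (M.+1 - (n - j)).+1)%N by lia.
  rewrite amul_rpowS; [|lia|lia].
  apply: subspaceD => //; first by rewrite subnSK ?(ltnW jn) //; apply: IHj; lia.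
  rewrite assE; [|lia|lia].
  have -> : (M.+1 - (n - j) + (n - j.+1) = M)%N by lia.
  by apply: Jass; lia.
have := Jprod n.-1 (ltac:(lia)).
have -> : (n - n.-1 = 1)%N by lia.
by rewrite subn1 -rpowS //; lia.
Qed.

Lemma rpow_solvable_mod I S x n : (0 < n)%N -> is_ideal I -> is_subspace S ->
  (forall k, (n <= k)%N -> S (rpow x k)) -> solvable_mod I S ->
  exists2 m, (0 < m)%N & forall k, (m <= k)%N -> I (rpow x k).
Proof.
move=> n0 iI sS Sx [m SI].
suff [N N0 SN] : exists2 N, (0 < N)%N &
    forall k, (N <= k)%N -> alg_derived S m (rpow x k).
  by exists N => // k /SN/SI.
elim: m {SI} => [|m [N N0 IHm]]; first by exists n.
(* Each squaring doubles the bound; the successor comes from the strict inequality in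
   [rpow_alg_square]. *)
exists N.*2.+1 => // k; apply: rpow_alg_square N0 _ IHm (fun _ => id) k.
exact: lin_span_subspace.
Qed.

(** By right commutativity [(ca)b] and [(cb)a] cancel, which leaves only associators. *)
Lemma amul_commutator c a b :
  c ∘ commutator a b = associator c b a - associator c a b.
Proof.
rewrite amulBr !amul_amulr (rc c b).
move: (associator c a b) (associator c b a) => s t.
by rewrite [- (_ - t)]opprB addrC addrA subrK.
Qed.

(** Twice the product is a sum of two commutators, the associators cancelling by left symmetry;
    characteristic not 2 allows the division. *)
Lemma lie_square_amulr I a b c : 2%N \notin [pchar F] ->
  is_ideal I -> I a -> I b -> lie_square I (commutator a b ∘ c).
Proof.
move=> hF iI Ia Ib; have sL := lie_square_subspace I.
have E : (2%:R : F) *: (commutator a b ∘ c) =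
    commutator (a ∘ c) b + commutator a (b ∘ c).
  rewrite /commutator amulBl scaler_nat mulr2n.
  rewrite (rc a c) (rc b c) !amul_amulr (ls b).
  move: (associator _ _ _) => s.
  rewrite opprB [s - _]addrC [X in _ = X + _]addrA.
  by rewrite [X in _ = _ + X]addrAC [RHS]addrACA subrr addr0.
have n2 : (2%:R : F) != 0.
  by apply: contra hF => n2; rewrite inE.
rewrite -[_ ∘ c](scalerK n2) E; apply: subspaceZ => //.
apply: subspaceD => //; apply: mem_lie_square => //; exact: idealMr.
Qed.

(** Up to the product from the other side, already treated, this is a difference of two
    commutators. *)
Lemma lie_square_amull I a b c : 2%N \notin [pchar F] ->
  is_ideal I -> I a -> I b -> lie_square I (c ∘ commutator a b).
Proof.
move=> hF iI Ia Ib; have sL := lie_square_subspace I.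
have -> : c ∘ commutator a b =
    commutator (c ∘ a) b - commutator (c ∘ b) a - commutator a b ∘ c.
  rewrite amul_commutator /commutator amulBl !amul_amulr.
  rewrite (rc c b) (rc a c) (rc b c) (ls a c) (ls b c).
  move: (associator c a b) (associator c b a) => s t.
  rewrite [- (c ∘ a ∘ b - (_ - s))]opprB.
  rewrite [X in _ = X - _]addrC addrA subrK opprB.
  by rewrite [_ - s]addrC [X in _ = X - _]addrACA addrK addrC.
apply: subspaceB => //; last exact: lie_square_amulr.
by apply: subspaceB => //; apply: mem_lie_square => //; apply: idealMl.
Qed.

Lemma lie_square_ideal I : 2%N \notin [pchar F] ->
  is_ideal I -> is_ideal (lie_square I).
Proof.
move=> hF iI; apply: lin_span_ideal => c _ [a Ia [b Ib <-]].
by split; [exact: lie_square_amull|exact: lie_square_amulr].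
Qed.

Lemma lie_derived_ideal n : 2%N \notin [pchar F] -> is_ideal (lie_derived A n).
Proof. by move=> hF; elim: n => //= n; apply: lie_square_ideal. Qed.

(** Commutativity of [I] kills the associators with two arguments in [I], and
  [w ∘ [a, b] ∘ v] is a difference of two of these, [(w ∘ v, b, a)] and
  [(w ∘ v, a, b)], up to a permutation of their first two arguments. *)
Lemma amul_commutator_amul0 I a b v w :
  is_ideal I -> (forall x y, I x -> I y -> x ∘ y = y ∘ x) ->
  I v -> I w -> w ∘ commutator a b ∘ v = 0.
Proof.
move=> iI Icom Iv Iw.
have ass0 x y z : I x -> I y -> associator x y z = 0.
  move=> Ix Iy; rewrite /associator (Icom x (y ∘ z)) //; last exact: idealMr.
  by rewrite (rc y z x) (Icom y x) // subrr.
have ass0v x y : associator x w y ∘ v = 0.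
  by rewrite -associator_amul; apply: ass0 => //; apply: idealMl.
rewrite amul_commutator.
by rewrite amulBl !(ls w) !ass0v subrr.
Qed.
End Novikov.

(** * Solvability of the commutator ideal of a Lie-solvable algebra *)

Section LieSolvable.
Variables (F : fieldType) (A : nonAssocAlgType F).
Hypotheses (hF : 2%N \notin [pchar F]) (novA : novikov A).
Implicit Types (I J K : set A) (a b c d u v w x y z : A).

(** Put [I = [J, J]]. The second factor of [(I I)(I I)] is weakened to some [q] in [I]; by linearity
    the first is [w [a, b]] with [w] in [I] and [a], [b] in [J]. Modulo [[I, I]] the ideal [I] is
    commutative, so [(w [a, b]) q] vanishes there. *)
Lemma alg_derived_lie_square J : is_ideal J ->
  alg_derived (lie_square J) 2 `<=` lie_square (lie_square J).
Proof.
move=> iJ; have iI := lie_square_ideal novA hF iJ.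
have iK := lie_square_ideal novA hF iI; have [[K0 KZD] KM] := iK.
set I := lie_square J in iI iK K0 KZD KM *.
have II : alg_square I `<=` I.
  by apply: alg_square_sub => [|x y Ix _]; [case: iI|exact: idealMr].
apply: alg_square_sub => [//|p q Ip /II Iq].
suff : alg_square I `<=` [set p | lie_square I (p ∘ q)] by exact.
apply: alg_square_sub => [|w u Iw Iu] /=.
  split=> [|c x y] /=; first by rewrite amul0l.
  by rewrite amulDl amulZl; apply: KZD.
suff : I `<=` [set u | lie_square I (w ∘ u ∘ q)] by exact.
apply: lie_square_sub => [|a b Ja Jb] /=.
  split=> [|c x y] /=; first by rewrite amul0r amul0l.
  by rewrite amulDr amulDl amulZr amulZl; apply: KZD.
pose KI := Ideal iK; apply/(quot_proj0 KI).
have comI (x y : quot_alg KI) :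
    (quot_proj KI @` I) x -> (quot_proj KI @` I) y -> x ∘ y = y ∘ x.
  move=> [x' Ix <-] [y' Iy <-]; rewrite -!quot_projMM.
  by apply/quot_projP; apply: mem_lie_square.
rewrite !quot_projMM quot_projB !quot_projMM -/(commutator _ _).
exact: (amul_commutator_amul0 (novikov_quot KI novA) _ _ (image_ideal KI iI) comI
  (imageP _ Iq) (imageP _ Iw)).
Qed.

Lemma lie_solvable_derived :
  lie_solvable A -> solvable_mod [set 0] (lie_derived A 1).
Proof.
(* Two squarings for each Lie step. The count starts at [[A, A]], so it ends at index [n + 1], where
   the Lie series still vanishes. *)
move=> [n An0]; exists n.*2.
have derA k : alg_derived (lie_derived A 1) k.*2 `<=` lie_derived A k.+1.
  elim: k => [//|k IHk]; rewrite doubleS -[_.+2]add2n alg_derivedD.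
  move=> x /(alg_derived_mono IHk) /alg_derived_lie_square; apply.
  exact: lie_derived_ideal.
have A0 : lie_derived A n.+1 `<=` [set 0].
  rewrite [lie_derived _ _]/(lie_square (lie_derived A n)) An0.
  apply: lie_square_sub; first exact: subspace0.
  by move=> _ _ -> ->; rewrite /commutator subrr.
by move=> x /derA /A0.
Qed.
End LieSolvable.

(** * Principal ideals in commutative Novikov algebras *)

Section CommutativeNovikov.
Variables (F : fieldType) (A : nonAssocAlgType F).
Hypotheses (novA : novikov A) (comA : forall x y : A, x ∘ y = y ∘ x).
Implicit Types (a x y z : A).

Lemma amulA x y z : x ∘ (y ∘ z) = x ∘ y ∘ z.
Proof. by case: novA => _ rc; rewrite comA rc (comA y x). Qed.

(** In the commutative case, the ideal generated by [x]; without a unit, the multiples [a x] alone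
    may miss [x]. *)
Definition principal x : set A := [set y | exists c a, y = c *: x + a ∘ x].

Lemma mem_principal x : principal x x.
Proof. by exists 1, 0; rewrite scale1r amul0l addr0. Qed.

Lemma principal_ideal x : is_ideal (principal x).
Proof.
split; first split.
- by exists 0, 0; rewrite scale0r amul0l addr0.
- move=> c _ _ [d [a ->]] [d' [a' ->]]; exists (c * d + d'), (c *: a + a').
  by rewrite scalerDr scalerA scalerDl amulDl amulZl addrACA.
move=> b _ [c [a ->]]; rewrite [_ ∘ b]comA; split; exists 0, (c *: b + b ∘ a);
  by rewrite scale0r add0r amulDr amulDl amulZl amulZr amulA.
Qed.

Lemma principal_square (K : set A) x :
  is_ideal K -> K (x ∘ x) -> alg_square (principal x) `<=` K.
Proof.
move=> iK Kxx; have sK := ideal_subspace iK.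
apply: alg_square_sub => // _ y [c [a ->]] [d [b ->]].
have Kxy : K (x ∘ (d *: x + b ∘ x)).
  rewrite amulDr amulZr (comA x (b ∘ x)) -amulA.
  by apply: subspaceD => //; [apply: subspaceZ|apply: idealMl].
rewrite amulDl amulZl -amulA.
by apply: subspaceD => //; [apply: subspaceZ|apply: idealMl].
Qed.

(** The square of [x^(n+1)] lies in the ideal generated by [x^(n+2)], so the exponent rises by one
    at each step; this crude count suffices. *)
Lemma alg_derived_principal x n :
  alg_derived (principal x) n `<=` principal (rpow x n.+1).
Proof.
case: novA => _ rc.
elim: n => //= n IHn y /(alg_square_mono IHn); apply: principal_square.
  exact: principal_ideal.
case: n {IHn y} => [|n]; first exact: mem_principal.
(* With [m = n + 2]: [x^m x^m = (x^m x^(m-1)) x = x^(m+1) x^(m-1)]. *)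
rewrite [X in _ ∘ X]rpowS // amulA rc -rpowS //.
by apply: idealMr (mem_principal _); apply: principal_ideal.
Qed.
End CommutativeNovikov.

(** * Solvable ideals around r-nilpotent elements *)

Section RNilToSolvable.
Variables (F : fieldType) (A : nonAssocAlgType F).
Hypotheses (hF : 2%N \notin [pchar F]) (novA : novikov A).
Hypothesis solA : lie_solvable A.

Lemma r_nilpotent_solvable_ideal (x : A) : r_nilpotent x ->
  exists J, [/\ is_ideal J, solvable_mod [set 0] J & J x].
Proof.
move=> [[//|n] _ xn0].
have iD : is_ideal (lie_derived A 1) by exact: lie_derived_ideal.
pose D := Ideal iD; pose Q := quot_alg D.
have comQ (u v : Q) : u ∘ v = v ∘ u.
  have [y <-] := quot_proj_surj u; have [z <-] := quot_proj_surj v.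
  by rewrite -!quot_projMM; apply/quot_projP/mem_lie_square.
have novQ := novikov_quot D novA.
(* Modulo [D] the derived series of this ideal lies in the ideals generated by the powers of [x], so
   [n] steps lead into [D], which is solvable. *)
exists (quot_proj D @^-1` principal (quot_proj D x)); split.
- by apply: preimage_ideal; apply: principal_ideal.
- have [m Dm] := lie_solvable_derived hF novA solA.
  exists (m + n)%N; rewrite alg_derivedD => y yJ; apply: Dm.
  apply: (alg_derived_mono _ yJ) => {y yJ} y.
  move/alg_derived_preimage.
  rewrite /preimage /= => /(alg_derived_principal novQ comQ).
  rewrite -quot_proj_rpow xn0 => -[c [a ya]]; apply/(quot_proj0 D).
  by rewrite ya quot_proj00 scaler0 amul0r addr0.
exact: mem_principal.
Qed.
End RNilToSolvable.

(** * Local solvability and r-nilpotency *)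

Section LocallySolvable.
Variables (F : fieldType) (A : nonAssocAlgType F).

Lemma generated_subalgebra_subalgebra (s : seq A) :
  is_subalgebra (generated_subalgebra s).
Proof.
split; first split.
- by move=> T [[[T0 _] _] _].
- move=> c x y Sx Sy T ST; case: (ST) => [[[_ TZD] _] _].
  by apply: TZD; [apply: Sx|apply: Sy].
- by move=> x y Sx Sy T ST; case: (ST) => [[_ TM] _]; apply: TM; [apply: Sx|apply: Sy].
Qed.

Lemma mem_generated_subalgebra (s : seq A) x :
  x \in s -> generated_subalgebra s x.
Proof. by move=> sx T [_]; apply. Qed.

Lemma generated_subalgebra_sub (s : seq A) T : is_subalgebra T ->
  (forall x, x \in s -> T x) -> generated_subalgebra s `<=` T.
Proof. by move=> sT Ts; apply: smallest_sub. Qed.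

Lemma r_nil_locally_solvable : 2%N \notin [pchar F] -> novikov A ->
  lie_solvable A -> r_nil A -> locally_solvable A.
Proof.
move=> hF novA solA nilA s.
have [|J [iJ [n J0] _ Js]] := @solvable_mod_seq F A [set 0] _ s id (ideal0 A).
  by move=> x _; apply: r_nilpotent_solvable_ideal.
apply/solvable_subalgebraP; first by case: (generated_subalgebra_subalgebra s).
exists n => x; move/alg_derived_mono => xS; apply/J0/xS.
by apply: generated_subalgebra_sub Js; apply: ideal_subalgebra.
Qed.

Lemma locally_solvable_r_nil : novikov A -> locally_solvable A -> r_nil A.
Proof.
move=> novA lsA x; pose S := generated_subalgebra [:: x].
have [sS SM] : is_subalgebra S by exact: generated_subalgebra_subalgebra.
have Sx : S x by apply: mem_generated_subalgebra; rewrite mem_head.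
have S0 : solvable_mod [set 0] S.
  by apply/(solvable_subalgebraP sS); exact: lsA.
have Sk k : (1 <= k)%N -> S (rpow x k).
  elim: k => // -[_ _|k IHk _]; first exact: Sx.
  by rewrite rpowS //; apply: SM => //; apply: IHk.
have [m m0 xm] := rpow_solvable_mod novA (ltn0Sn 0) (ideal0 A) sS Sk S0.
by exists m => //; apply: xm.
Qed.
End LocallySolvable.

(** * Order properties derived from unique minima *)

Section WellOrders.
Variables (W : Type) (le : rel W).
Hypothesis wo : well_order le.

Lemma well_order_min (P : set W) :
  P !=set0 -> exists2 z, P z & forall x, P x -> le z x.
Proof.
move=> [x Px]; have [|z [[/asboolP Pz zmin] _]] := wo (A := fun t => `[< P t >]).
  by exists x; apply/asboolP.
by exists z => // y Py; apply: zmin; apply/asboolP.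
Qed.

Lemma well_order_refl x : le x x.
Proof.
by have [|z -> ] := @well_order_min [set x]; [exists x|apply].
Qed.

Lemma well_order_total x y : le x y \/ le y x.
Proof.
have [|z [] -> zmin] := @well_order_min [set x; y]; first by exists x; left.
  by left; apply: zmin; right.
by right; apply: zmin; left.
Qed.

Lemma well_order_anti x y : le x y -> le y x -> x = y.
Proof.
move=> xy yx; have [|z [_ zu]] := wo (A := fun t => `[< [set x; y] t >]).
  by exists x; apply/asboolP; left.
rewrite -(zu x) ?(zu y) //; split=> [|t /asboolP [] ->] //.
- by apply/asboolP; right.
- exact: well_order_refl.
- by apply/asboolP; left.
- exact: well_order_refl.
Qed.

(** If the minimum of the three elements is [y] or [z], antisymmetry identifies it with its
    predecessor in the chain. *)
Lemma well_order_trans x y z : le x y -> le y z -> le x z.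
Proof.
move=> xy yz; have [|m mS mmin] := @well_order_min [set t | [\/ t = x, t = y | t = z]].
  by exists x; constructor 1.
have mx : le m x by apply: mmin; constructor 1.
have my : le m y by apply: mmin; constructor 2.
have mz : le m z by apply: mmin; constructor 3.
case: mS => Em; rewrite {}Em in mx my mz => //.
  by rewrite (well_order_anti xy mx).
by rewrite -(well_order_anti yz my).
Qed.

Lemma wlt_not_le x y : ~ le y x -> wlt le x y.
Proof.
move=> yx; split; first by have [] := well_order_total x y.
by move=> xy; apply: yx; rewrite xy; apply: well_order_refl.
Qed.

Lemma wlt_le_trans x y z : wlt le x y -> le y z -> wlt le x z.
Proof.
move=> [xy nxy] yz; split; first exact: well_order_trans yz.
by move=> xz; apply: nxy; apply: well_order_anti => //; rewrite xz.
Qed.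

Lemma wlt_wf : well_founded (wlt le).
Proof.
move=> w; apply: contrapT => nw.
have [|z nz zmin] := @well_order_min [set w | ~ Acc (wlt le) w]; first by exists w.
apply: nz; constructor=> v [vz nvz]; apply: contrapT => nv.
by apply: nvz; apply: well_order_anti (zmin _ nv).
Qed.

Lemma least_succ_limit w :
  [\/ is_least le w, exists v, is_succ le v w | is_limit le w].
Proof.
have [wl|wnl] := pselect (is_least le w); first by constructor 1.
have [ws|wns] := pselect (exists v, is_succ le v w); first by constructor 2.
by constructor 3; split=> // v vw; apply: wns; exists v.
Qed.

End WellOrders.

(** * A greatest element added to a well-order, and Cantor's diagonal argument *)

Section WithTop.
Variables (T : Type) (le : rel T).

Definition le_top (x y : option T) : bool :=
  match x, y with
  | _, None => true
  | None, Some _ => false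
  | Some a, Some b => le a b
  end.

Lemma well_order_top : well_order le -> well_order le_top.
Proof.
move=> wo P [x Px].
have [[a Pa]|nP] := pselect (exists a, Some a \in P).
  have [|z [[Pz zmin] zu]] := wo (fun a => Some a \in P); first by exists a.
  exists (Some z); split=> [|[y [Py ymin]|[_ /(_ _ Pa)]//]].
    by split=> // -[y|//] /zmin.
  by rewrite (zu y) //; split=> // t Pt; exact: (ymin (Some t)).
have PN y : y \in P -> y = None.
  by case: y => // y Py; case: nP; exists y.
have PN0 : None \in P by rewrite -(PN _ Px).
by exists None; split=> [|y [/PN ->]//]; split=> // y /PN ->.
Qed.

End WithTop.

(** Diagonal argument: for injective [f], both answers to whether [f D] lies in [D] are
    contradictory. It will bound strictly growing chains in [A]. *)
Lemma set_not_injective (T : Type) (f : set T -> T) : ~ injective f.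
Proof.
move=> finj; pose D := [set f S | S in [set S | ~ S (f S)]].
have nD : ~ D (f D).
  by move=> [S nS /finj SD]; apply: (nS); rewrite {1}SD;
  exact: (imageP f nS).
exact: (nD (imageP f nD)).
Qed.

(** * One step of the Baer chain *)

Section BaerStep.
Variables (F : fieldType) (A : nonAssocAlgType F).
Implicit Types (I J : ideal A) (x y : A).

Lemma baer1_ideal (B : nonAssocAlgType F) : is_ideal (baer1 B).
Proof.
split; first split.
- by exists [::] => //; rewrite big_nil.
- move=> c _ _ [s sP ->] [t tP ->]; exists (map ( *:%R c) s ++ t).
    move=> y; rewrite mem_cat => /orP [/mapP [z /sP [I tI Iz] ->]|/tP //].
    by exists I => //; case: tI => iI _; apply: subspaceZ => //; case: iI.
  by rewrite big_cat big_map scaler_sumr.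
move=> a _ [s sP ->]; split.
  exists (map (amul a) s).
    move=> y /mapP [z /sP [I tI Iz] ->]; exists I => //; case: tI => iI _.
    exact: idealMl.
  rewrite big_map; apply: (big_morph (amul a)); [exact: amulDr|exact: amul0r].
exists (map (amul^~ a) s).
  move=> y /mapP [z /sP [I tI Iz] ->]; exists I => //; case: tI => iI _.
  exact: idealMr.
rewrite big_map; apply: (big_morph (amul^~ a)); last exact: amul0l.
by move=> x y; apply: amulDl.
Qed.

Definition baer_next I : set A := quot_proj I @^-1` baer1 (quot_alg I).

Lemma baer_next_ideal I : is_ideal (baer_next I).
Proof. by apply: preimage_ideal; apply: baer1_ideal. Qed.

Lemma sub_baer_next I : ideal_set I `<=` baer_next I.
Proof. by apply: ideal_sub_preimage; apply: baer1_ideal. Qed.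

(** Modulo [I], [x] is a finite sum of elements of trivial ideals; the preimages of these ideals
    square into [I], so their sum is solvable modulo [I]. *)
Lemma baer_next_solvable_mod I x : baer_next I x ->
  exists J : set A, [/\ is_ideal J, solvable_mod I J & J x].
Proof.
move=> [s sT xs]; have iI := idealP I.
have [u /sT [T [iT T2] Tu]|J [iJ sJ IJ Js]] := @solvable_mod_seq F A I _ s repr iI.
  exists (quot_proj I @^-1` T); split.
  - exact: preimage_ideal.
  - exists 1%N => y /alg_derived_preimage.
    rewrite /preimage /= /alg_derived /= T2 => /quot_proj0; exact.
  - by rewrite /preimage /= quot_projK.
(* [x] differs from the sum of the representatives by an element of [I], and [J] contains [I]. *)
exists J; split=> //; rewrite -(subrK (\sum_(u <- s) repr u) x).
apply: subspaceD; [exact: ideal_subspace| |]; last first.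
  by apply: subspace_sum => //; apply: ideal_subspace.
apply/IJ/quot_projP; rewrite quot_proj_sum xs.
by apply: eq_bigr => u _; rewrite quot_projK.
Qed.

Lemma baer_next_grows I (P : set A) x : novikov A ->
  is_ideal P -> solvable_mod [set 0] P -> P x -> ~ ideal_set I x ->
  exists2 y, baer_next I y & ~ ideal_set I y.
Proof.
move=> novA iP [n Pn] Px nIx; have [[I0 _] _] := idealP I.
have exn : exists n, `[< alg_derived P n `<=` ideal_set I >].
  by exists n; apply/asboolP => y /Pn ->.
(* [k + 1] is the least index at which the derived series is inside [I]; index 0 is excluded by
   [x]. *)
have [[|k] /asboolP Pk kmin] := ex_minnP exn; first by have /nIx := Pk _ Px.
have [y Py nIy] : exists2 y, alg_derived P k y & ~ ideal_set I y.
  apply: contrapT => nE; have : (k.+1 <= k)%N; last by rewrite ltnn.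
  apply: kmin; apply/asboolP => y Py; apply: contrapT => nIy.
  by apply: nE; exists y.
have iJ := alg_derived_ideal novA k iP.
exists y => //; exists [:: quot_proj I y]; last by rewrite big_seq1.
move=> u; rewrite inE => /eqP ->.
exists (quot_proj I @` alg_derived P k); last by exists y.
split; first exact: image_ideal.
apply/seteqP; split=> [|_ ->]; last first.
  by case: (alg_square_subspace (quot_proj I @` alg_derived P k)).
apply: alg_square_sub => [|_ _ [a Pa <-] [b Pb <-]]; first exact: subspace0.
by rewrite -quot_projMM; apply/quot_proj0/Pk/mem_alg_square.
Qed.

End BaerStep.

(** * Baer-radical algebras are r-nil *)

Section BaerToRNil.
Variables (F : fieldType) (A : nonAssocAlgType F).
Hypothesis novA : novikov A.
Variables (W : Type) (le : rel W) (B : W -> ideal A).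
Hypotheses (wo : well_order le) (chB : baer_chain le B).

(** The exponent varies in the induction: at a successor, the powers from [x^n] on lie in an ideal
    solvable modulo the previous stage, so some other power of [x] lies in that stage. *)
Lemma baer_chain_r_nilpotent w n x :
  (0 < n)%N -> ideal_set (B w) (rpow x n) -> r_nilpotent x.
Proof.
elim/(well_founded_ind (wlt_wf wo)): w n => w IHw n n0.
have [w0|[v vw]|wl] := least_succ_limit le w.
- by rewrite (baer_chain0 chB w0) => xn; exists n.
- rewrite (baer_chainS chB vw) => /baer_next_solvable_mod [J [iJ sJ Jx]].
  have Jk k : (n <= k)%N -> J (rpow x k).
    elim: k => [|k IHk]; first by rewrite leqn0 => /eqP <-.
    rewrite leq_eqVlt => /orP [/eqP <- //|nk].
    by rewrite rpowS ?(leq_trans n0) //; apply: idealMr => //; apply: IHk.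
  have [m m0 xm] := rpow_solvable_mod novA n0 (idealP _) (ideal_subspace iJ) Jk sJ.
  by case: vw => vw _; apply: (IHw v vw m m0); apply: xm.
by rewrite (baer_chainL chB wl) => -[v vw]; apply: IHw.
Qed.

End BaerToRNil.

(** * Construction of the Baer chain along a well-order *)

Section BaerChain.
Variables (F : fieldType) (A : nonAssocAlgType F).
Variables (W : Type) (le : rel W).
Hypothesis wo : well_order le.

Lemma smallest_ideal (S : set A) : is_ideal (smallest (@is_ideal F A) S).
Proof.
split; first split.
- by move=> T [[[T0 _] _] _].
- move=> c x y Sx Sy T ST; case: (ST) => [[[_ TZD] _] _].
  by apply: TZD; [apply: Sx|apply: Sy].
by move=> a x Sx; split=> T ST; case: (ST) => [iT _];
   [apply: idealMl|apply: idealMr] => //; apply: Sx.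
Qed.

(** One formula covers zero, successor and limit stages, which makes the recursion free of cases;
    [baer_stage_chain] recovers the three clauses. *)
Definition baer_stage_step w (f : forall v, wlt le v w -> ideal A) : ideal A :=
  Ideal (smallest_ideal [set x | exists v (vw : wlt le v w), baer_next (f v vw) x]).

Definition baer_stage : W -> ideal A :=
  Fix (wlt_wf wo) (fun=> ideal A) baer_stage_step.

Lemma baer_stageE w : ideal_set (baer_stage w) =
  smallest (@is_ideal F A) (\bigcup_(v in [set v | wlt le v w]) baer_next (baer_stage v)).
Proof.
rewrite /baer_stage Fix_eq; last first.
  move=> v f g fg; congr (baer_stage_step).
  apply: functional_extensionality_dep => u.
  by apply: functional_extensionality_dep => uv.
rewrite /=; congr smallest; apply/seteqP; split=> [x [v [vw xv]]|x [v vw xv]].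
  by exists v.
by exists v, vw.
Qed.

Lemma baer_stage_next v w :
  wlt le v w -> baer_next (baer_stage v) `<=` baer_stage w.
Proof.
by move=> vw x xv; rewrite baer_stageE => T [_]; apply; exists v.
Qed.

Lemma baer_stage_mono v w : wlt le v w -> baer_stage v `<=` baer_stage w.
Proof. by move=> vw x /sub_baer_next; apply: baer_stage_next. Qed.

Lemma baer_stage_min w (I : set A) : is_ideal I ->
  (forall v, wlt le v w -> baer_next (baer_stage v) `<=` I) ->
  baer_stage w `<=` I.
Proof.
move=> iI wI; rewrite baer_stageE; apply: smallest_sub => // x [v vw].
exact: wI.
Qed.

Lemma baer_stage_chain : baer_chain le baer_stage.
Proof.
split=> [w w0|v w [vw wv]|w [wnl wns]]; apply/seteqP; split.
- by apply: baer_stage_min => [|v /w0 //]; apply: ideal0.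
- by move=> x ->; case: (idealP (baer_stage w)) => [] [].
- apply: baer_stage_min => [|u /wv uv]; first exact: baer_next_ideal.
  have [<-//|nuv] := pselect (u = v).
  by move=> x /(@baer_stage_next u v) -/(_ (conj uv nuv)) /sub_baer_next.
- exact: baer_stage_next.
- have wE : exists v, wlt le v w.
    by apply: contrapT => nE; apply: wnl => v vw; apply: nE; exists v.
  (* As [v] is not a predecessor of the limit [w], some [u] lies strictly between, and stage [u]
     absorbs the step after [v]. *)
  have cofinal v : wlt le v w -> exists2 u, wlt le v u & wlt le u w.
    move=> vw; apply: contrapT => nE; apply: (wns v); split=> // u uw.
    apply: contrapT => /(wlt_not_le wo) vu; apply: nE.
    by exists u.
  apply: baer_stage_min => [|v /cofinal [u vu uw] x xv]; last first.
    by exists u => //; apply: baer_stage_next xv.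
  split; first split.
  + by have [v vw] := wE; exists v => //; case: (idealP (baer_stage v)) => [] [].
  + move=> c x y [u uw xu] [v vw yv].
    have [m [mw xm ym]] : exists m,
        [/\ wlt le m w, ideal_set (baer_stage m) x & ideal_set (baer_stage m) y].
      have [uv|vu] := well_order_total wo u v.
        exists v; split=> //; have [<-//|nuv] := pselect (u = v).
        exact: baer_stage_mono xu.
      exists u; split=> //; have [<-//|nvu] := pselect (v = u).
      exact: baer_stage_mono yv.
    by exists m => //; case: (idealP (baer_stage m)) => [] [_ ZD] _; apply: ZD.
  + move=> a x [v vw xv]; have [_ /(_ a x xv) [? ?]] := idealP (baer_stage v).
    by split; exists v.
- by move=> x [v vw]; apply: baer_stage_mono.
Qed.

End BaerChain.

(** * Growth of the chain up to the whole algebra *)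

Section RNilToBaer.
Variables (F : fieldType) (A : nonAssocAlgType F).

(** Stages are indexed by [set A]. If none of them were the whole algebra, each would be followed by
    a new element, which would inject [set A] into [A]. *)
Lemma solvable_ideals_baer_radical : novikov A ->
  (forall x : A, exists P, [/\ is_ideal P, solvable_mod [set 0] P & P x]) ->
  baer_radical_algebra A.
Proof.
move=> novA solP; apply/seteqP; split=> // x _.
have [le0 wo0] := well_ordering_principle (set A).
(* Two tops: [Some None] has a copy of [set A] below it, and [None] is strictly above that, as
   [exceeds_card] demands. *)
pose le := le_top (le_top le0).
have wo : well_order le by do 2![apply: well_order_top].
pose B := baer_stage A wo; pose top : option (option (set A)) := None.
exists (option (option (set A))), le, B, top; split=> //.
- exact: baer_stage_chain.
- exists (Some None) => //.
  pose f (y : A) : option (option (set A)) := Some (Some [set y]).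
  have finj : {in [set: A] &, injective f}.
    by move=> y z _ _ [] /(congr1 (fun S : set A => S y)) /= <-.
  apply: (@card_le_trans _ _ _ (f @` [set: A])).
    by rewrite (card_le_eqr (inj_card_eq finj)).
  by apply: subset_card_le => _ [y _ <-].
have [[S BS]|nB] := pselect (exists S, ideal_set (B (Some (Some S))) = [set: A]).
  by apply: (@baer_stage_mono _ _ _ _ wo (Some (Some S))) => //; rewrite -/B BS.
have /choice [f fP] : forall S : set A, exists y,
    baer_next (B (Some (Some S))) y /\ ~ ideal_set (B (Some (Some S))) y.
  move=> S; have [y nBy] : exists y, ~ ideal_set (B (Some (Some S))) y.
    apply: contrapT => nE; apply: nB; exists S; apply/seteqP; split=> // y _.
    by apply: contrapT => nBy; apply: nE; exists y.
  have [P [iP sP Py]] := solP y.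
  by have [z] := baer_next_grows novA iP sP Py nBy; exists z.
(* [f S] enters in the step after stage [S], so it lies in every later stage [T], whereas [f T] does
   not lie in stage [T]. *)
have flt S T : le0 S T -> f S = f T -> S = T.
  move=> ST fST; apply: contrapT => nST; have [_ []] := fP T.
  rewrite -fST; apply: (@baer_stage_next _ _ _ _ wo (Some (Some S))).
    by split=> // -[].
  by have [] := fP S.
case: (@set_not_injective A f) => S T fST.
have [ST|TS] := well_order_total wo0 S T; first exact: flt.
by apply/esym/flt.
Qed.

End RNilToBaer.

Theorem theorem3p2 (F : fieldType) (hF : 2%N \notin [pchar F]%R)
    (A : nonAssocAlgType F) (novA : novikov A) (solA : lie_solvable A) :
  (baer_radical_algebra A <-> r_nil A) /\
  (r_nil A <-> locally_solvable A).
Proof.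
split; split.
- move=> baerA x; have : [set: A] x by [].
  rewrite baerA => -[W [le [B [delta [wo chB _ Bx]]]]].
  exact: (baer_chain_r_nilpotent novA wo chB (ltn0Sn 0) Bx).
- move=> nilA; apply: solvable_ideals_baer_radical => // x.
  exact: r_nilpotent_solvable_ideal.
- exact: r_nil_locally_solvable.
- exact: locally_solvable_r_nil.
Qed.
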